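(* Let $\Gamma$ be a Coxeter graph with associated pure Artin group $P$. If $\Gamma$ contains an $A_3$ subgraph, then $P$ is not residually free.
   Context: A Coxeter graph $\Gamma$ is a finite simple graph with vertex set $S$ in which each edge $\{s,t\}$ carries a value $m_{s,t}\in\{3,4,5,\dots\}\cup\{\infty\}$; an edge is unlabelled when $m_{s,t}=3$, and $m_{s,t}=2$ for distinct non-adjacent $s,t$. The associated Artin group $A$ has generating set $S$ and relations $sts\cdots=tst\cdots$ ($m_{s,t}$ factors on each side) for all distinct $s,t\in S$ with $m_{s,t}<\infty$. The associated Coxeter group $W$ is the quotient of $A$ obtained by adding the relations $s^2=1$ for $s\in S$, and the pure Artin group is $P=\ker(A\to W)$. $\Gamma$ contains an $A_k$ subgraph if it contains, as a vertex-induced subgraph, a path on $k$ vertices all of whose edges are unlabelled. A group $G$ is residually free if for every $x\neq 1$ in $G$ there is a homomorphism $f$ from $G$ to a free group $F$ with $f(x)\neq 1$. *)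

(* Defs.v *)
From HB Require Import structures.
From mathcomp Require Import all_boot boolp.

Set Implicit Arguments.
Unset Strict Implicit.
Unset Printing Implicit Defensive.

Local Open Scope group_scope.
Local Open Scope quotient_scope.

(* The letter (x, true) stands for x, and (x, false) for x^-1. *)
Definition word (X : Type) := seq (X * bool).

Definition inv_word X (w : word X) : word X :=
  rev [seq (l.1, ~~ l.2) | l <- w].

(* A set of relations is a binary relation on words; [R u v] reads "u = v". *)
Inductive pres_eq (X : Type) (R : word X -> word X -> Prop) :
    word X -> word X -> Prop :=
  | pres_eq_rel u v : R u v -> pres_eq R u v
  | pres_eq_cancel x b : pres_eq R [:: (x, b); (x, ~~ b)] [::]
  | pres_eq_cat u u' v v' :
      pres_eq R u u' -> pres_eq R v v' -> pres_eq R (u ++ v) (u' ++ v')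
  | pres_eq_refl u : pres_eq R u u
  | pres_eq_sym u v : pres_eq R u v -> pres_eq R v u
  | pres_eq_trans u v w : pres_eq R u v -> pres_eq R v w -> pres_eq R u w.

Section PresentedGroup.
Variables (X : choiceType) (R : word X -> word X -> Prop).

Definition pres_eqb : rel (word X) := fun u v => `[< pres_eq R u v >].

Lemma pres_eqb_refl : reflexive pres_eqb.
Proof. by move=> u; apply/asboolP; apply: pres_eq_refl. Qed.

Lemma pres_eqb_sym : symmetric pres_eqb.
Proof.
by move=> u v; apply/asboolP/asboolP => h; apply: pres_eq_sym.
Qed.

Lemma pres_eqb_trans : transitive pres_eqb.
Proof.
move=> v u w /asboolP uv /asboolP vw; apply/asboolP.
exact: pres_eq_trans uv vw.
Qed.

Canonical pres_equiv :=
  EquivRel pres_eqb pres_eqb_refl pres_eqb_sym pres_eqb_trans.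

Definition presented := {eq_quot pres_equiv}.

HB.instance Definition _ := Choice.on presented.
HB.instance Definition _ := EqQuotient.on presented.

Definition pclass (w : word X) : presented := \pi_presented w.

Lemma pclassP u v : pclass u = pclass v <-> pres_eq R u v.
Proof.
split=> [/eqP|h]; last by apply/eqP; rewrite /pclass piE; apply/asboolP.
by rewrite /pclass piE => /asboolP.
Qed.

Lemma pclassK (a : presented) : pclass (repr a) = a.
Proof. by rewrite /pclass reprK. Qed.

Lemma inv_word_cat (u v : word X) :
  inv_word (u ++ v) = inv_word v ++ inv_word u.
Proof. by rewrite /inv_word map_cat rev_cat. Qed.

Lemma inv_wordK : involutive (@inv_word X).
Proof.
move=> w; rewrite /inv_word map_rev revK -map_comp -[RHS]map_id.
by apply: eq_map => -[x b] /=; rewrite negbK.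
Qed.

Lemma pres_eq_mulV (w : word X) : pres_eq R (w ++ inv_word w) [::].
Proof.
elim: w => [|[x b] w IHw]; first exact: pres_eq_refl.
rewrite -cat1s inv_word_cat catA -(catA _ w).
apply: pres_eq_trans (pres_eq_cancel R x b).
rewrite -[X in pres_eq _ _ X]/([:: (x, b)] ++ [:: (x, ~~ b)]).
apply: pres_eq_cat; last exact: pres_eq_refl.
rewrite -[X in pres_eq _ _ X]cats0.
by apply: pres_eq_cat => //; apply: pres_eq_refl.
Qed.

Lemma pres_eq_inv u v :
  pres_eq R u v -> pres_eq R (inv_word u) (inv_word v).
Proof.
move=> uv; have refl := pres_eq_refl R.
apply: (@pres_eq_trans _ _ _ (inv_word u ++ (v ++ inv_word v))).
  rewrite -[X in pres_eq _ X _]cats0; apply: pres_eq_cat => //.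
  exact/pres_eq_sym/pres_eq_mulV.
rewrite catA -[X in pres_eq _ _ X]cat0s; apply: pres_eq_cat => //.
apply: (@pres_eq_trans _ _ _ (inv_word u ++ u)).
  by apply: pres_eq_cat => //; apply: pres_eq_sym.
by have := pres_eq_mulV (inv_word u); rewrite inv_wordK.
Qed.

Definition pres_mul (a b : presented) : presented :=
  pclass (repr a ++ repr b).
Definition pres_inv (a : presented) : presented := pclass (inv_word (repr a)).

Lemma pres_mulE u v : pres_mul (pclass u) (pclass v) = pclass (u ++ v).
Proof. by apply/pclassP/pres_eq_cat; apply/pclassP; rewrite pclassK. Qed.

Lemma pres_invE u : pres_inv (pclass u) = pclass (inv_word u).
Proof. by apply/pclassP/pres_eq_inv/pclassP; rewrite pclassK. Qed.

Lemma pres_mulA : associative pres_mul.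
Proof.
move=> a b c; rewrite -(pclassK a) -(pclassK b) -(pclassK c).
by rewrite !pres_mulE catA.
Qed.

Lemma pres_mul1 : left_id (pclass [::]) pres_mul.
Proof. by move=> a; rewrite -(pclassK a) pres_mulE. Qed.

Lemma pres_mulr1 : right_id (pclass [::]) pres_mul.
Proof. by move=> a; rewrite -(pclassK a) pres_mulE cats0. Qed.

Lemma pres_mulVl : left_inverse (pclass [::]) pres_inv pres_mul.
Proof.
move=> a; rewrite -(pclassK a) pres_invE pres_mulE; apply/pclassP.
by have := pres_eq_mulV (inv_word (repr a)); rewrite inv_wordK.
Qed.

Lemma pres_mulVr : right_inverse (pclass [::]) pres_inv pres_mul.
Proof.
move=> a; rewrite -(pclassK a) pres_invE pres_mulE.
exact/pclassP/pres_eq_mulV.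
Qed.

HB.instance Definition _ := isGroup.Build presented
  pres_mulA pres_mul1 pres_mulr1 pres_mulVl pres_mulVr.

End PresentedGroup.

Definition free_group (X : choiceType) : groupType :=
  presented (fun _ _ : word X => False).

(* The canonical map <X | R> -> <X | R'>; it is well defined when the
   relations R' include the relations R. *)
Definition pres_proj (X : choiceType) (R R' : word X -> word X -> Prop)
  (a : presented R) : presented R' := pclass R' (repr a).

Lemma pres_eq_sub (X : choiceType) (R R' : word X -> word X -> Prop) :
  (forall u v, R u v -> R' u v) ->
  forall u v, pres_eq R u v -> pres_eq R' u v.
Proof.
move=> RR' u v; elim=> {u v}.
- by move=> u v /RR'; apply: pres_eq_rel.
- by move=> x b; apply: pres_eq_cancel.
- by move=> u u' v v' _ h1 _ h2; apply: pres_eq_cat.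
- by move=> u; apply: pres_eq_refl.
- by move=> u v _; apply: pres_eq_sym.
- by move=> u v w _ h1 _; apply: pres_eq_trans.
Qed.

Lemma pres_projE (X : choiceType) (R R' : word X -> word X -> Prop) :
  (forall u v, R u v -> R' u v) ->
  forall w, pres_proj R' (pclass R w) = pclass R' w.
Proof.
move=> RR' w; apply/pclassP/(pres_eq_sub RR')/pclassP.
by rewrite pclassK.
Qed.

Lemma pres_projM (X : choiceType) (R R' : word X -> word X -> Prop) :
  (forall u v, R u v -> R' u v) ->
  {morph @pres_proj X R R' : a b / a * b >-> a * b}.
Proof.
move=> RR' a b; rewrite -(pclassK a) -(pclassK b).
by rewrite [_ * _]pres_mulE !(pres_projE RR') [RHS]pres_mulE.
Qed.

Section Kernel.
Variables (G H : groupType) (f : {multiplicative G -> H}).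

Definition ker_pred : pred G := fun x => f x == 1.

Lemma ker_pred_closed : group_closed ker_pred.
Proof.
have f1 : f 1 = 1 by apply: (mulgI (f 1)); rewrite -gmulfM !mulg1.
have fV x : f x^-1 = (f x)^-1.
  by apply: (mulgI (f x)); rewrite -gmulfM !mulgV f1.
split=> [|x y]; rewrite !unfold_in /ker_pred ?f1 //.
by move=> /eqP fx /eqP fy; rewrite gmulfM fV fx fy mulgV.
Qed.

Record kernel := Kernel { kernel_val :> G; _ : ker_pred kernel_val }.

HB.instance Definition _ := [isSub for kernel_val].
HB.instance Definition _ := [Choice of kernel by <:].
HB.instance Definition _ :=
  SubChoice_isSubGroup.Build G ker_pred kernel ker_pred_closed.

End Kernel.

Definition residually_free (G : groupType) : Prop :=
  forall x : G, x <> 1 ->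
  exists (X : choiceType) (f : {multiplicative G -> free_group X}), f x <> 1.

(* The label None stands for infinity; labels of non-adjacent pairs are
   irrelevant. *)
Record coxeter_graph := CoxeterGraph {
  vertex :> finType;
  adj : rel vertex;
  label : vertex -> vertex -> option nat;
  adj_sym : symmetric adj;
  adj_irrefl : irreflexive adj;
  label_sym : forall s t, adj s t -> label s t = label t s;
  label_ge3 : forall s t m, adj s t -> label s t = Some m -> (3 <= m)%N
}.

(* Only meaningful for distinct s and t; None again stands for infinity. *)
Definition coxeter_m (Gamma : coxeter_graph) (s t : Gamma) : option nat :=
  if adj s t then label s t else Some 2.

(* The positive word s t s t ... with n letters. *)
Definition alt_word (X : Type) (s t : X) (n : nat) : word X :=
  mkseq (fun i => (if odd i then t else s, true)) n.

Definition artin_rel (Gamma : coxeter_graph) (u v : word Gamma) : Prop :=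
  exists (s t : Gamma) (m : nat),
    [/\ s <> t, coxeter_m s t = Some m,
        u = alt_word s t m & v = alt_word t s m].

Definition square_rel (Gamma : coxeter_graph) (u v : word Gamma) : Prop :=
  exists s : Gamma, u = [:: (s, true); (s, true)] /\ v = [::].

Definition coxeter_rel (Gamma : coxeter_graph) (u v : word Gamma) : Prop :=
  artin_rel u v \/ square_rel u v.

Definition artin_group (Gamma : coxeter_graph) : groupType :=
  presented (@artin_rel Gamma).

Definition coxeter_group (Gamma : coxeter_graph) : groupType :=
  presented (@coxeter_rel Gamma).

Definition artin_to_coxeter (Gamma : coxeter_graph) :
    artin_group Gamma -> coxeter_group Gamma :=
  @pres_proj Gamma (@artin_rel Gamma) (@coxeter_rel Gamma).

Lemma artin_to_coxeterM (Gamma : coxeter_graph) :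
  {morph @artin_to_coxeter Gamma : a b / a * b >-> a * b}.
Proof. by apply: pres_projM => u v; left. Qed.

HB.instance Definition _ (Gamma : coxeter_graph) :=
  isMultiplicative.Build (artin_group Gamma) (coxeter_group Gamma)
    (@artin_to_coxeter Gamma) (@artin_to_coxeterM Gamma).

Definition pure_artin_group (Gamma : coxeter_graph) : groupType :=
  kernel (@artin_to_coxeter Gamma).

Definition contains_A (k : nat) (Gamma : coxeter_graph) : Prop :=
  exists f : 'I_k -> Gamma,
    [/\ injective f,
        forall i j : 'I_k, adj (f i) (f j) = (i.+1 == j) || (j.+1 == i)
      & forall i j : 'I_k, adj (f i) (f j) -> label (f i) (f j) = Some 3].

(* Main.v *)
Require Import Defs.
From mathcomp Require Import all_boot all_order all_algebra all_field.
From mathcomp Require Import boolp ring ssrZ.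

Set Implicit Arguments.
Unset Strict Implicit.
Unset Printing Implicit Defensive.

Import GRing.Theory Num.Theory.

(** Commuting is a transitive relation on the nontrivial elements of a free
group.  The proof exhibits a nontrivial element of [P] that dies in every
group with this property, hence in every free group.

Let [a], [b], [c] be the three generators of the A_3 subgraph, and put
[x = a^2], [y = b^2], [z = b^-1 c^2 b]; the subgroup of the pure braid group
on four strands generated by [x], [y], [z] is the free group formed by the
braids in which only one fixed strand moves.  Let [w = x y z],
[u = b^-1 a^2 b] and [v = c^2].  The braid relations give three facts:
[u x y = (ab)^3] commutes with [x] and [y]; [v y z = (cb)^3] commutes with
[y] and [z]; and [w] commutes with [u] and [v].  Let [f] map to a group in
which commuting is transitive.
- If [f (u x y)] is nontrivial, then [f x] and [f y] commute.
- If [f (v y z)] is nontrivial, then [f y] and [f z] commute.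
- If both are trivial, then [f (x y)] and [f (y z)] are the inverses of [f u]
  and [f v], so they commute with [f w], and so do [f x] and [f y].  Hence
  either [f w] is trivial or [f x] and [f y] commute.
In all cases [f] kills the element [[[x, y], [y, z]], w]
([obstruction_trivial], [braid_obstruction_relations]).

Transitivity of commuting in free groups
([free_group_commutation_transitive]) comes from representations by 2x2
matrices over Z[t] that are faithful on any finite set of generators: for 2x2
matrices over a domain, the centraliser of a matrix that is not scalar is
commutative.

That [[[x, y], [y, z]], w] survives in [P] ([braid_obstruction_neq1]) is seen
in a linear representation of the whole Artin group: the reflection
representation of the Hecke algebra at [q = 4], over the algebraic numbers.  On
the coordinates [a], [b], [c] it restricts to the reduced Burau
representation, in which the element is moved by a computation with integers.
This direct construction replaces the theorem that standard parabolic
subgroups of Artin groups are themselves Artin groups. *)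

(** * An element killed by commutation-transitive quotients *)

Section Obstruction.
Local Open Scope group_scope.

Definition commutation_transitive (G : groupType) :=
  forall x y z : G, x <> 1 -> commute x y -> commute x z -> commute y z.

(** Killed as soon as [x] commutes with [y], or [y] with [z], or [x * y * z] is
trivial; the relations of [obstruction_trivial] force one of the three. *)
Definition obstruction (G : groupType) (x y z : G) : G :=
  [~ [~ [~ x, y], [~ y, z]], x * y * z].

Lemma obstruction_trivial (G : groupType) (x y z u v : G) :
    commutation_transitive G ->
    commute (u * x * y) x -> commute (u * x * y) y ->
    commute (v * y * z) y -> commute (v * y * z) z ->
    commute (x * y * z) u -> commute (x * y * z) v ->
  obstruction x y z = 1.
Proof.
move=> CT ux uy vy vz wu wv; rewrite /obstruction.
have [uxy1|uxy1] := eqVneq (u * x * y) 1; last first.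
  have /commgP/eqP -> := CT _ _ _ (elimN eqP uxy1) ux uy.
  by rewrite comm1g comm1g.
have [vyz1|vyz1] := eqVneq (v * y * z) 1; last first.
  have /commgP/eqP -> := CT _ _ _ (elimN eqP vyz1) vy vz.
  by rewrite commg1 comm1g.
have [w1|w1] := eqVneq (x * y * z) 1; first by rewrite w1 commg1.
set w := x * y * z in wu wv w1 *.
(* Now x y and y z are the inverses of u and v, so w centralises them. *)
have wxy : commute w (x * y).
  suff -> : x * y = u^-1 by apply: commuteV.
  by apply: (mulgI u); rewrite mulgV mulgA.
have wyz : commute w (y * z).
  suff -> : y * z = v^-1 by apply: commuteV.
  by apply: (mulgI v); rewrite mulgV mulgA.
have wx : commute w x.
  have -> : x = w * (y * z)^-1 by rewrite /w -(mulgA x) mulgK.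
  by apply: commuteM; [apply: commute_refl | apply: commuteV].
have wy : commute w y.
  have -> : y = x^-1 * (x * y) by rewrite mulKg.
  by apply: commuteM => //; apply: commuteV.
have /commgP/eqP -> := CT _ _ _ (elimN eqP w1) wx wy.
by rewrite comm1g comm1g.
Qed.

Lemma gmulf_commg (G H : groupType) (f : {multiplicative G -> H}) :
  {morph f : x y / [~ x, y]}.
Proof.
have f1 : f 1 = 1 by apply: (mulgI (f 1)); rewrite -gmulfM !mulg1.
have fV x : f x^-1 = (f x)^-1.
  by apply: (mulgI (f x)); rewrite -gmulfM !mulgV f1.
by move=> x y; rewrite /commg /conjg !gmulfM !fV.
Qed.

Lemma gmulf_obstruction (G H : groupType)
    (f : {multiplicative G -> H}) (x y z : G) :
  f (obstruction x y z) = obstruction (f x) (f y) (f z).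
Proof. by rewrite /obstruction !gmulf_commg !gmulfM. Qed.


Lemma obstruction_killed (G : groupType) (F : groupType)
    (f : {multiplicative G -> F}) (x y z u v : G) :
  commutation_transitive F ->
  [/\ commute (u * x * y) x, commute (u * x * y) y,
      commute (v * y * z) y, commute (v * y * z) z &
      commute (x * y * z) u /\ commute (x * y * z) v] ->
  f (obstruction x y z) = 1.
Proof.
move=> CT [ux uy vy vz [wu wv]]; rewrite gmulf_obstruction.
have fc s t : commute s t -> commute (f s) (f t).
  by rewrite /commute -!gmulfM => ->.
by apply: (obstruction_trivial (u := f u) (v := f v) CT);
  rewrite -!gmulfM; apply: fc.
Qed.

(** The element is [(ab)^3], the full twist on three strands. *)
Lemma braid_center (G : groupType) (a b : G) : a * b * a = b * a * b ->
  commute (a * a * b * a * a * b) a /\ commute (a * a * b * a * a * b) b.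
Proof.
move=> ab.
have abx x : x * a * b * a = x * b * a * b.
  by rewrite -!mulgA (mulgA a) ab !mulgA.
rewrite /commute !mulgA; split.
  by rewrite (abx (a * a * b * a)) -(abx (a * a)).
by rewrite (abx a) -(abx (a * b * a)) (abx (b * a)) -ab.
Qed.

Section BraidRelations.
Variables (G : groupType) (a b c : G).
Hypotheses (ab : a * b * a = b * a * b) (cb : c * b * c = b * c * b).
Hypothesis ac : commute a c.

Let x := a * a.
Let y := b * b.
Let z := (c * c) ^ b.
Let u := (a * a) ^ b.
Let v := c * c.

Let uxy : u * x * y = a * a * b * a * a * b.
Proof.
apply: (mulgI b); rewrite /u /x /y conjgE !mulgA mulgV mul1g.
by have [_] := braid_center ab; rewrite /commute !mulgA => <-.
Qed.

Let vyz : v * y * z = c * c * b * c * c * b.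
Proof. by rewrite /v /y /z conjgE !mulgA mulgK. Qed.

Let w : x * y * z = a * a * b * c * c * b.
Proof. by rewrite /x /y /z conjgE !mulgA mulgK. Qed.

(** Both [u * x * y] and [v * y * z] are full twists of braid pairs, covered by
[braid_center]; [w] commutes with [c], and with [a ^ b = a * b * a^-1]. *)
Lemma braid_obstruction_relations :
  [/\ commute (u * x * y) x, commute (u * x * y) y,
      commute (v * y * z) y, commute (v * y * z) z &
      commute (x * y * z) u /\ commute (x * y * z) v].
Proof.
have [Da Db] := braid_center ab; have [Ec Eb] := braid_center cb.
have abx t : t * a * b * a = t * b * a * b.
  by rewrite -!mulgA (mulgA a) ab !mulgA.
have cbx t : t * c * b * c = t * b * c * b.
  by rewrite -!mulgA (mulgA c) cb !mulgA.
have acx t : t * a * c = t * c * a by rewrite -!mulgA ac.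
split; rewrite ?uxy ?vyz ?w.
- exact: commuteM.
- exact: commuteM.
- exact: commuteM.
- by rewrite /z conjgE; apply: commuteM; [apply: commuteV|do !apply: commuteM].
split; last first.
  suff h : commute (a * a * b * c * c * b) c by apply: commuteM.
  rewrite /commute !mulgA -ac -(acx a).
  by rewrite (cbx (a * a * b * c)) (cbx (a * a)).
rewrite /u conjMg; suff h : commute (a * a * b * c * c * b) (a ^ b).
  exact: commuteM.
have ->: a ^ b = a * b * a^-1.
  by apply: (mulgI b); rewrite conjgE !mulgA mulgV mul1g -ab mulgK.
apply: (mulIg a); rewrite /commute !mulgA !mulgVK.
rewrite -(abx a) (acx (a * a * b)) (acx (a * a * b * c)).
by rewrite (abx (a * a * b * c * c)).
Qed.
End BraidRelations.

End Obstruction.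

(** * Commutation in free groups *)

Section Matrices.
Local Open Scope ring_scope.

Definition mx2 (R : Type) (a b c d : R) : 'M[R]_2 :=
  \matrix_(i, j) if i == 0 then if j == 0 then a else b
                 else if j == 0 then c else d.

Lemma eq_mx2 (R : Type) (A B : 'M[R]_2) :
  A 0 0 = B 0 0 -> A 0 1 = B 0 1 -> A 1 0 = B 1 0 -> A 1 1 = B 1 1 -> A = B.
Proof.
move=> h1 h2 h3 h4; apply/matrixP => i j.
have ord2 (k : 'I_2) : k = 0 \/ k = 1.
  by case: k => [[|[|//]] ?]; [left|right]; apply/val_inj.
by case: (ord2 i) => ->; case: (ord2 j) => ->.
Qed.

Lemma mulmx2E (R : pzRingType) (A B : 'M[R]_2) i j :
  (A *m B) i j = A i 0 * B 0 j + A i 1 * B 1 j.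
Proof.
rewrite mxE big_ord_recl big_ord1.
by congr (_ + A _ _ * B _ _); apply/val_inj.
Qed.

(** Commuting with [A] means that the vector [(M 0 1, M 1 0, M 1 1 - M 0 0)] is
proportional to that of [A], and two vectors proportional to the same nonzero
vector are proportional to each other. *)
Lemma comm_mx2_trans (R : idomainType) (A B C : 'M[R]_2) :
  A 0 1 != 0 -> comm_mx A B -> comm_mx A C -> comm_mx B C.
Proof.
move=> A01 AB AC.
have prop (M : 'M[R]_2) : comm_mx A M ->
    A 0 1 * M 1 0 = A 1 0 * M 0 1 /\
    A 0 1 * (M 1 1 - M 0 0) = (A 1 1 - A 0 0) * M 0 1.
  move=> AM; have h i j : (A *m M) i j = (M *m A) i j by rewrite AM.
  have := h 0 0; have := h 0 1; rewrite !mulmx2E => h01 h00; split.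
    by apply: (addrI (A 0 0 * M 0 0)); rewrite h00; ring.
  have -> : A 0 1 * (M 1 1 - M 0 0) = (A 0 0 * M 0 1 + A 0 1 * M 1 1)
     - A 0 0 * M 0 1 - A 0 1 * M 0 0 by ring.
  by rewrite h01; ring.
have [B10 B11] := prop _ AB; have [C10 C11] := prop _ AC.
have K1 : B 0 1 * (C 1 1 - C 0 0) = C 0 1 * (B 1 1 - B 0 0).
  by apply: (mulfI A01); rewrite mulrCA C11 [RHS]mulrCA B11; ring.
have K2 : B 1 0 * C 0 1 = C 1 0 * B 0 1.
  by apply: (mulfI A01); rewrite mulrA B10 [RHS]mulrA C10; ring.
have K3 : B 1 0 * (C 1 1 - C 0 0) = C 1 0 * (B 1 1 - B 0 0).
  apply: (mulfI A01); rewrite mulrA B10 [RHS]mulrA C10.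
  by rewrite -!(mulrA (A 1 0)) K1.
apply: eq_mx2; rewrite !mulmx2E; apply/eqP; rewrite -subr_eq0; apply/eqP.
- by rewrite (mulrC (B 0 1)) -K2; ring.
- by rewrite -[RHS](subrr (C 0 1 * (B 1 1 - B 0 0))) -{1}K1; ring.
- by rewrite -[RHS](subrr (B 1 0 * (C 1 1 - C 0 0))) {1}K3; ring.
- by rewrite K2; ring.
Qed.

End Matrices.

Section FreeGroup.
Local Open Scope ring_scope.
Variables (X : choiceType) (code : X -> nat).

Implicit Types (w : word X) (l : X * bool).

Definition fixed_pts k : 'M[{poly int}]_2 :=
  mx2 1 1 (2 * k%:R) (2 * k%:R + 1).

Definition fixed_coords k : 'M[{poly int}]_2 :=
  mx2 (2 * k%:R + 1) (- 1) (- (2 * k%:R)) 1.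

Definition hyperbolic (b : bool) : 'M[{poly int}]_2 :=
  if b then mx2 'X (- 1) 1 0 else mx2 0 1 (- 1) 'X.

(** To leading order in ['X], a generator with code [k] acts on the projective
line as a hyperbolic element with attracting point [(1, 2k)] and repelling point
[(1, 2k + 1)], and its inverse the other way round.  Integer points at distance
one make the change of basis unimodular, so no denominators appear, and the
parameter ['X] replaces the large real number of the usual ping-pong
argument. *)
Definition schottky_mx l : 'M[{poly int}]_2 :=
  fixed_pts (code l.1) *m hyperbolic l.2 *m fixed_coords (code l.1).

Definition schottky w : 'M[{poly int}]_2 :=
  foldr (fun l M => schottky_mx l *m M) 1%:M w.

Lemma schottky_mxV x b : schottky_mx (x, b) *m schottky_mx (x, ~~ b) = 1%:M.
Proof.
have BK k : fixed_coords k *m fixed_pts k = 1%:M.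
  by apply: eq_mx2; rewrite mulmx2E !mxE /=; ring.
have KB k : fixed_pts k *m fixed_coords k = 1%:M.
  by apply: eq_mx2; rewrite mulmx2E !mxE /=; ring.
have hypV : hyperbolic b *m hyperbolic (~~ b) = 1%:M.
  by case: b; apply: eq_mx2; rewrite mulmx2E !mxE /=; ring.
rewrite /schottky_mx /= !mulmxA -(mulmxA _ (fixed_coords _)) BK mulmx1.
by rewrite -(mulmxA _ (hyperbolic b)) hypV mulmx1 KB.
Qed.

Lemma schottky_cat u v : schottky (u ++ v) = schottky u *m schottky v.
Proof. by elim: u => [|l u IHu] /=; rewrite ?mul1mx // IHu mulmxA. Qed.

Lemma schottky_pres_eq u v :
  pres_eq (fun _ _ => False) u v -> schottky u = schottky v.
Proof.
elim=> {u v} //.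
- by move=> x b; rewrite /= mulmx1 schottky_mxV.
- by move=> u u' v v' _ uu' _ vv'; rewrite !schottky_cat uu' vv'.
- by move=> u v w _ -> _ ->.
Qed.

Definition attractor l : int := ((code l.1).*2 + ~~ l.2)%:R.

Definition top_coef n (P : {poly int}) p :=
  (forall i, (n < i)%N -> P`_i = 0) /\ P`_n = p.

Lemma top_coefB n P Q p q :
  top_coef n P p -> top_coef n Q q -> top_coef n (P - Q) (p - q).
Proof.
move=> [P0 Pn] [Q0 Qn]; split=> [i ni|]; rewrite coefB ?Pn ?Qn //.
by rewrite P0 ?Q0 ?subrr.
Qed.

Lemma top_coefMn n P p m : top_coef n P p -> top_coef n (m%:R * P) (m%:R * p).
Proof.
move=> [P0 Pn]; split=> [i ni|]; rewrite !mulr_natl coefMn ?Pn //.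
by rewrite P0 ?mul0rn.
Qed.

Lemma top_coefXD n P Q p q :
  top_coef n P p -> top_coef n Q q -> top_coef n.+1 ('X * P + Q) p.
Proof.
move=> [P0 Pn] [Q0 Qn]; split=> [[//|i] ni|]; rewrite coefD coefXM /=.
  by rewrite P0 ?Q0 ?addr0 // ltnW.
by rewrite Q0 ?addr0.
Qed.

Definition lead_col n p q (M : 'M[{poly int}]_2) :=
  top_coef n (M 0 1) p /\ top_coef n (M 1 1) q.

(** At leading order in ['X] a letter acts as the projection onto its attracting
point along its repelling point, which is the attracting point of the inverse
letter. *)
Lemma lead_col_step l n p q M : lead_col n p q M ->
  let d := (-1) ^+ (~~ l.2) * (attractor (l.1, ~~ l.2) * p - q) in
  lead_col n.+1 d (d * attractor l) (schottky_mx l *m M).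
Proof.
case=> [Pp Qq]; rewrite /schottky_mx /attractor; set k := code l.1.
set P := M 0 1 in Pp; set Q := M 1 1 in Qq.
(* L and N are the coordinates of the column in the basis of fixed points. *)
pose L := k.*2.+1%:R * P - Q; pose N := Q - k.*2%:R * P.
have Lt : top_coef n L (k.*2.+1%:R * p - q).
  by apply: top_coefB => //; apply: top_coefMn.
have Nt : top_coef n N (q - k.*2%:R * p).
  by apply: top_coefB => //; apply: top_coefMn.
have k0 : k.*2%:R = 2 * k%:R :> {poly int} by rewrite -mul2n natrM.
have k1 : k.*2.+1%:R = 2 * k%:R + 1 :> {poly int} by rewrite -k0 -natr1.
set A := _ *m M; rewrite /lead_col.
have [-> ->] :
  A 0 1 = (if l.2 then 'X * L + (L - N) else 'X * N + (N - L)) /\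
  A 1 1 = (if l.2
           then 'X * (k.*2%:R * L) + (k.*2.+1%:R * L - k.*2%:R * N)
           else 'X * (k.*2.+1%:R * N) + (k.*2%:R * N - k.*2.+1%:R * L)).
  rewrite /A /L /N /P /Q k0 k1 /fixed_pts /fixed_coords !mulmx2E !mxE /=.
  clear; move: (M 0 1) (M 1 1) (k%:R) (l.2) => P Q t b.
  by split; case: b; rewrite /hyperbolic !mxE /=; ring.
clearbody L N; clear A.
case: (l.2) => /=; rewrite ?addn0 ?addn1 ?expr0 ?expr1 ?mul1r ?mulN1r ?opprB.
- split; first by apply: top_coefXD Lt (top_coefB Lt Nt).
  rewrite (mulrC (_ - _)); apply: top_coefXD (top_coefMn _ Lt) _.
  by apply: top_coefB; apply: top_coefMn; eassumption.
- split; first by apply: top_coefXD Nt (top_coefB Nt Lt).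
  rewrite (mulrC (_ - _)); apply: top_coefXD (top_coefMn _ Nt) _.
  by apply: top_coefB; apply: top_coefMn; eassumption.
Qed.

Definition reduced w := sorted (fun l l' => l' != (l.1, ~~ l.2)) w.

Lemma attractor_inj (D : {pred X}) : {in D &, injective code} ->
  {in [pred l | l.1 \in D] &, injective attractor}.
Proof.
move=> inj [x b] [y c] /= xD yD; rewrite /attractor /= => /eqP.
rewrite eqr_nat => /eqP e.
have bc : b = c.
  move: e => /(congr1 odd); rewrite !oddD !odd_double; clear.
  by case: b c => -[].
rewrite bc in e *; congr (_, _); apply: inj => //.
by move/addIn: e => /double_inj.
Qed.

(** The second column has, at leading order, the direction of the attracting
point of the first letter: no cancellation occurs, since the word being reduced
means that the image of each projection is off the kernel of the next. *)
Lemma schottky_reduced w :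
  {in [seq l.1 | l <- w] &, injective code} -> reduced w -> w != [::] ->
  schottky w 0 1 != 0.
Proof.
case: w => // l w inj red_w _.
suff [p p0 [[_ e] _]] : exists2 p, p != 0 &
    lead_col (size (l :: w)) p (p * attractor l) (schottky (l :: w)).
  by apply: contraNneq p0 => e0; rewrite -e e0 coef0.
elim: w l inj red_w => [|l' w IHw] l inj /= => [_|/andP[ll' red_w]].
  have /(lead_col_step l) : lead_col 0 0 1 1%:M.
    rewrite /lead_col !mxE /=; split; split=> [i i0|].
    - exact: coef0.
    - exact: coef0.
    - by rewrite coef1 gtn_eqF.
    - by rewrite coef1.
  rewrite /= mulr0 sub0r => h; eexists; last exact: h.
  by rewrite mulf_neq0 ?signr_eq0 ?oppr_eq0.
have [|//|p p0 /(lead_col_step l) /= h] := IHw l'.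
  by move=> x y xw yw; apply: inj; rewrite inE ?xw ?yw orbT.
eexists; last exact: h.
rewrite (mulrC p) -mulrBl !mulf_neq0 ?signr_eq0 // subr_eq0.
apply: contraNneq ll' => e; apply/eqP/esym.
by apply: (attractor_inj inj) e; rewrite !inE eqxx ?orbT.
Qed.

End FreeGroup.

Section Reduction.
Variable X : choiceType.

Lemma reduced_word (w : word X) :
  exists2 v : word X, reduced v & pres_eq (fun _ _ => False) w v.
Proof.
elim: w => [|l w [v red_v wv]]; first by exists [::] => //; apply: pres_eq_refl.
have lwv : pres_eq (fun _ _ => False) (l :: w) (l :: v).
  by rewrite -cat1s -(cat1s l v); apply: pres_eq_cat wv; apply: pres_eq_refl.
case: v red_v {wv} lwv => [|l' v] red_v lwv; first by exists [:: l].
have [e|ll'] := eqVneq l' (l.1, ~~ l.2); last first.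
  by exists (l :: l' :: v) => //; rewrite /= ll'.
exists v; first exact: path_sorted red_v.
apply: pres_eq_trans lwv _; rewrite e -[X in pres_eq _ _ X]cat0s.
rewrite -[l :: _]/([:: l; (l.1, ~~ l.2)] ++ v).
by case: l {e} => x b; apply: pres_eq_cat;
  [apply: pres_eq_cancel | apply: pres_eq_refl].
Qed.

Local Open Scope group_scope.

(** Only the generators occurring in [x] and in [[y, z]] need distinct codes, so
the index in a finite list serves as a code even when [X] is uncountable. *)
Lemma free_group_commutation_transitive :
  commutation_transitive (free_group X).
Proof.
move=> x y z x1 xy xz.
have red (a : free_group X) : exists2 v, reduced v & a = pclass _ v.
  have [v red_v wv] := reduced_word (repr a); exists v => //.
  by rewrite -[LHS]pclassK; apply/pclassP.
have [v red_v xv] := red x; have [r red_r rE] := red [~ y, z].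
pose letters := [seq l.1 | l <- v] ++ [seq l.1 | l <- r].
pose code (s : X) := index s letters.
pose S (a : free_group X) := schottky code (repr a).
have SE u : S (pclass _ u) = schottky code u.
  by apply: schottky_pres_eq; apply/pclassP; rewrite pclassK.
have SM a b : S (a * b) = (S a *m S b)%R.
  by rewrite -(pclassK a) -(pclassK b) [_ * _]pres_mulE !SE schottky_cat.
have Scomm a b : commute a b -> comm_mx (S a) (S b).
  by rewrite /comm_mx -!SM => ->.
have S01 u : {subset [seq l.1 | l <- u] <= letters} ->
    reduced u -> u != [::] -> (S (pclass _ u) 0 1)%R != 0%R.
  move=> sub red_u u0; rewrite SE; apply: schottky_reduced => //.
  by move=> s t /sub su /sub tu /index_inj; apply.
have Syz : comm_mx (S y) (S z).
  apply: comm_mx2_trans (Scomm _ _ xy) (Scomm _ _ xz); rewrite xv.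
  apply: S01 => //.
    by move=> s sv; rewrite mem_cat sv.
  by apply: contra_notN x1 => /eqP v0; rewrite xv v0.
apply/commgP/eqP; rewrite rE; have [->//|r0] := eqVneq r [::].
have : (S [~ y, z] 0 1)%R != 0%R.
  by rewrite rE; apply: S01 => // s sr; rewrite mem_cat sr orbT.
have S1 : S 1 = 1%:M%R by exact: (SE [::]).
suff -> : S [~ y, z] = S 1 by rewrite S1 mxE eqxx.
by rewrite /commg /conjg !SM Syz -!SM mulKg mulVg.
Qed.

End Reduction.

(** * A linear representation of the Artin group *)

Section Hecke.
Local Open Scope ring_scope.
Variables (K : fieldType) (Gamma : coxeter_graph).
Variables (q : K) (c : Gamma -> Gamma -> K).

(** A q-deformed reflection, in the dual of the usual reflection representation:
in the dual, the values at a set of vertices after the action of a generator of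
that set depend on the values at that set only, so the representation of a
full subgraph can be read off directly. *)
Definition hecke_letter (l : Gamma * bool) (f : Gamma -> K) : Gamma -> K :=
  fun t => if l.2 then if t == l.1 then - (q * f t) else f t + c l.1 t * f l.1
  else if t == l.1 then - (q^-1 * f t) else f t + q^-1 * (c l.1 t * f l.1).

Definition hecke (w : word Gamma) (f : Gamma -> K) : Gamma -> K :=
  foldr hecke_letter f w.

Lemma hecke_cat u v f : hecke (u ++ v) f = hecke u (hecke v f).
Proof. exact: foldr_cat. Qed.

(** Here [l] and [r] are the eigenvalues of a generator composed with the swap
of the coordinates of two vertices; equality of their [m]-th powers gives the
braid relation of length [m] in this plane.  The last condition makes the
form on the plane nondegenerate.  For [q = 1] the value [x] would be
[2 cos (pi / m)], up to the choice of a root of unity. *)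
Definition dihedral_bond m (x : K) :=
  exists l r : K, [/\ l * r = q, l + r = x, l != r, l ^+ m = r ^+ m
                    & x ^+ 2 != (1 + q) ^+ 2].

Hypothesis q0 : q != 0.
Hypothesis c_sym : forall s t, c s t = c t s.
Hypothesis cP : forall s t m, s <> t -> coxeter_m s t = Some m ->
  dihedral_bond m (c s t).

Lemma alt_wordS (T : Type) (s t : T) n :
  alt_word s t n.+1 = (s, true) :: alt_word t s n.
Proof.
rewrite /alt_word /mkseq /= -[1%N]addn0 iotaDl -map_comp; congr (_ :: _).
by apply: eq_map => i /=; case: odd.
Qed.

(** Since the two generators alternate, each step is the same linear map once
the two coordinates are swapped; the forms [p] are its eigenvectors. *)
Lemma hecke_alt_eigen (s t : Gamma) (l r : K) f n : s <> t ->
    l * r = q -> l + r = c s t ->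
  let p x y (g : Gamma -> K) := l * g x + g y in
  p t s (hecke (alt_word s t n) f) =
    l ^+ n * (if odd n then p s t f else p t s f) /\
  p s t (hecke (alt_word t s n) f) =
    l ^+ n * (if odd n then p t s f else p s t f).
Proof.
move=> /eqP st lr lpr /=.
have ts : t == s = false by rewrite eq_sym; apply/negbTE.
have lq x : l * (c s t * x) = l * (l * x) + q * x by rewrite -lpr -lr; ring.
elim: n => [|n [IHs IHt]]; first by rewrite /= !expr0 !mul1r.
rewrite !alt_wordS /= /hecke_letter /= !eqxx (negbTE st) ts (c_sym t s).
rewrite !mulrDr !lq exprS -!mulrA; split.
- set h := hecke _ _ in IHt *.
  transitivity (l * (l * h s + h t)); first by ring.
  by rewrite IHt; case: (odd n).
- set g := hecke (alt_word s t n) f in IHs *.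
  transitivity (l * (l * g t + g s)); first by ring.
  by rewrite IHs; case: (odd n).
Qed.

Lemma hecke_alt_plane (s t : Gamma) m f : s <> t -> coxeter_m s t = Some m ->
  let g := hecke (alt_word s t m) f in let h := hecke (alt_word t s m) f in
  g s = h s /\ g t = h t.
Proof.
move=> st stm; have [l [r [lr lpr l_r lrm _]]] := cP st stm.
have [] := hecke_alt_eigen f m st lr lpr.
have [] :=
  hecke_alt_eigen f m st (etrans (mulrC _ _) lr) (etrans (addrC _ _) lpr).
rewrite /= -lrm; set k := l ^+ m; set g := hecke _ _; set h := hecke _ _.
have lr0 : l - r != 0 by rewrite subr_eq0.
have two (a b a' b' : K) : l * a + b = k * (l * a' + b') ->
    r * a + b = k * (r * a' + b') -> a = k * a' /\ b = k * b'.
  move=> e1 e2; have ea : a = k * a'.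
    apply: (mulfI lr0); transitivity ((l * a + b) - (r * a + b)); first by ring.
    by rewrite e1 e2; ring.
  by split=> //; apply: (addrI (l * a)); rewrite e1 ea; ring.
by case: (odd m) => rs rt ls lt; have [-> ->] := two _ _ _ _ ls rs;
  have [-> ->] := two _ _ _ _ lt rt.
Qed.

(** Each generator changes a function by a multiple of one fixed function, so
the change is governed by two scalars only. *)
Lemma hecke_pair_change (s t : Gamma) n f : s <> t ->
  exists x y : K, forall u,
    hecke (alt_word s t n) f u - f u =
      (if u == s then - (1 + q) else c s u) * x
      + (if u == t then - (1 + q) else c t u) * y.
Proof.
elim: n s t => [|n IHn] s t st.
  by exists 0, 0 => u; rewrite /= subrr !mulr0 addr0.
have [y [x xy]] := IHn t s (nesym st).
rewrite alt_wordS /=; move: (hecke _ _) xy => g xy.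
exists (x + g s), y => u; rewrite /hecke_letter /=.
move/(_ u): xy; case: (eqVneq u s) => [->|us] e; rewrite ?eqxx.
  move: (if s == t then _ else _) e => k e.
  by transitivity ((g s - f s) - (1 + q) * g s); [ring|rewrite e; ring].
move: (if u == t then _ else _) e => k e.
by transitivity ((g u - f u) + c s u * g s); [ring|rewrite e; ring].
Qed.

(** The two sides agree at [s] and [t], and their changes there determine the
two scalars of [hecke_pair_change], by nondegeneracy; hence they agree at every
vertex. *)
Lemma hecke_braid (s t : Gamma) m f : s <> t -> coxeter_m s t = Some m ->
  hecke (alt_word s t m) f = hecke (alt_word t s m) f.
Proof.
move=> st stm; have [/= gs gt] := hecke_alt_plane f st stm.
have [_ [_ [_ _ _ _ gram]]] := cP st stm.
have [x [y xy]] := hecke_pair_change m f st.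
have [y' [x' xy']] := hecke_pair_change m f (nesym st).
have ts : t == s = false by apply/eqP; apply: nesym.
have st' : s == t = false by apply/eqP.
have e1 := xy s; have e2 := xy t; have e3 := xy' s; have e4 := xy' t.
rewrite !eqxx ?ts ?st' ?(c_sym t s) in e1 e2 e3 e4.
rewrite gs e3 in e1; rewrite gt e4 in e2.
have D0 : (c s t) ^+ 2 - (1 + q) ^+ 2 != 0 by rewrite subr_eq0.
have xx : x = x'.
  apply: (mulfI D0).
  transitivity (c s t * (c s t * x + - (1 + q) * y)
    + (1 + q) * (- (1 + q) * x + c s t * y)); first by ring.
  by rewrite -e1 -e2; ring.
have yy : y = y'.
  apply: (mulfI D0).
  transitivity ((1 + q) * (c s t * x + - (1 + q) * y)
    + c s t * (- (1 + q) * x + c s t * y)); first by ring.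
  by rewrite -e1 -e2; ring.
apply/funext => u; apply: (addIr (- f u)).
by rewrite xy xy' xx yy; apply: addrC.
Qed.

Lemma hecke_pres_eq u v f :
  pres_eq (@artin_rel Gamma) u v -> hecke u f = hecke v f.
Proof.
move=> uv; elim: uv f => {u v} //.
- move=> u v [s [t [m [st stm -> ->]]]] f.
  exact: hecke_braid.
- move=> s b f; apply/funext => t; rewrite /= /hecke_letter /=.
  by case: b => /=; rewrite eqxx; case: eqP => [->|_]; field.
- by move=> u u' v v' _ uu' _ vv' f; rewrite !hecke_cat vv' uu'.
- by move=> u v w _ uv _ vw f; rewrite uv.
Qed.

End Hecke.

Section Bond.
Local Open Scope ring_scope.

(** A primitive root of unity of order [2 * m] when [m] is positive; the
predecessor lets the definition be total. *)
Definition dihedral_root m : algC :=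
  sval (C_prim_root_exists (ltn0Sn (m.*2.-1))).

(** The factor [2] is a square root of [q = 4].  Pairs labelled by infinity are
subject to no relation, hence the arbitrary value [0]. *)
Definition bond (o : option nat) : algC :=
  if o is Some m then 2 * (dihedral_root m + (dihedral_root m)^-1) else 0.

Lemma dihedral_rootP m : (0 < m)%N ->
  (m.*2).-primitive_root (dihedral_root m).
Proof.
move=> m0; rewrite /dihedral_root; case: C_prim_root_exists => z /=.
by rewrite prednK ?double_gt0.
Qed.

Lemma dihedral_root_expn m : (0 < m)%N -> dihedral_root m ^+ m = -1.
Proof.
move=> m0; have zP := dihedral_rootP m0; set z := dihedral_root m in zP *.
have /eqP : (z ^+ m) ^+ 2 = 1 by rewrite -exprM muln2 prim_expr_order.
rewrite sqrf_eq1 => /orP[|/eqP//].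
by rewrite -(prim_order_dvd zP) -muln2 -{2}[m]muln1 dvdn_pmul2l.
Qed.

Lemma bond_dihedral m : (2 <= m)%N -> dihedral_bond 4 m (bond (Some m)).
Proof.
move=> m2; have m0 : (0 < m)%N by apply: leq_trans m2.
have zP := dihedral_rootP m0; have zm := dihedral_root_expn m0.
rewrite /bond; set z := dihedral_root m in zP zm *.
have z0 : z != 0.
  apply: contra_eq_neq zm => ->.
  by rewrite expr0n gtn_eqF // eq_sym oppr_eq0 oner_eq0.
have pow1 k : k%:R ^+ m = 1 :> algC -> (k == 1)%N.
  by move/eqP; rewrite -natrX pnatr_eq1 -{1}(exp1n m) eqn_exp2r.
have z2m : (z ^+ 2) ^+ m = 1 by rewrite -exprM mulnC exprM zm sqrrN expr1n.
exists (2 * z), (2 * z^-1); split.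
- by field.
- by ring.
- apply/eqP => e; have : z ^+ 2 = 1.
    have {e} : z = z^-1 by apply: (mulfI (_ : 2%:R != 0)) e; rewrite pnatr_eq0.
    by move=> e; rewrite expr2 {2}e mulfV.
  move/eqP; rewrite -(prim_order_dvd zP) -[2%N]/(1.*2) -!muln2.
  by rewrite dvdn_pmul2r // dvdn1 => /eqP m1; rewrite m1 in m2.
- by rewrite !exprMn exprVn zm invrN1.
- rewrite -subr_eq0.
  have -> : (2 * (z + z^-1)) ^+ 2 - (1 + 4) ^+ 2 =
     (z ^+ 2 - 4%:R) * (4%:R * z ^+ 2 - 1) / z ^+ 2 by field.
  rewrite !mulf_neq0 ?invr_eq0 ?expf_neq0 // subr_eq0; apply/eqP => e.
    by have /pow1 : 4%:R ^+ m = 1 :> algC by rewrite -e.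
  have /pow1 // : 4%:R ^+ m = 1 :> algC.
  by rewrite -[LHS]mulr1 -[X in _ * X = _]z2m -exprMn e expr1n.
Qed.

Lemma bond2 : bond (Some 2) = 0.
Proof.
have /= := @dihedral_root_expn 2 isT; set z := dihedral_root 2 => z2.
have z0 : z != 0.
  by apply: contra_eq_neq z2 => ->; rewrite expr0n eq_sym oppr_eq0 oner_eq0.
apply: (mulfI z0); rewrite /bond -/z mulr0.
have -> : z * (2 * (z + z^-1)) = 2 * (z ^+ 2 + 1) by field.
by rewrite z2 addNr mulr0.
Qed.

Lemma bond3 : bond (Some 3) = 2.
Proof.
have /= := @dihedral_root_expn 3 isT; have zP := @dihedral_rootP 3 isT.
rewrite /bond; set z := dihedral_root 3 in zP *; move => z3.
have z1 : z + 1 != 0.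
  rewrite addr_eq0; apply/eqP => e.
  have /eqP : z ^+ 2 = 1 by rewrite e sqrrN expr1n.
  by rewrite -(prim_order_dvd zP).
have z0 : z != 0.
  by apply: contra_eq_neq z3 => ->; rewrite expr0n eq_sym oppr_eq0 oner_eq0.
apply: (mulfI z0); apply: (mulfI z1); apply/eqP; rewrite -subr_eq0; apply/eqP.
have -> : (z + 1) * (z * (2 * (z + z^-1))) - (z + 1) * (z * 2)
  = 2 * (z ^+ 3 + 1) by field.
by rewrite z3 addNr mulr0.
Qed.

End Bond.

(** * Survival of the element in the pure Artin group *)

Lemma coxeter_mC (Gamma : coxeter_graph) (s t : Gamma) :
  coxeter_m s t = coxeter_m t s.
Proof.
by rewrite /coxeter_m adj_sym; case: ifP => // ts; rewrite label_sym // adj_sym.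
Qed.

Lemma coxeter_m_ge2 (Gamma : coxeter_graph) (s t : Gamma) m :
  coxeter_m s t = Some m -> (2 <= m)%N.
Proof.
by rewrite /coxeter_m; case: ifP => [st /(label_ge3 st)/ltnW|_ [<-]].
Qed.

Section Burau.
Local Open Scope ring_scope.
Import BinInt.

(** The restriction of [hecke] to the coordinates at the path [a], [b], [c],
numbered 0, 1, 2, in binary integers for computation.  Inverse letters are
multiplied by [q = 4] to clear denominators. *)
Definition burau_letter (l : nat * bool) (v : Z * Z * Z) : Z * Z * Z :=
  let: (x, y, z) := v in
  match l with
  | (0, true) => (- (4 * x), y + 2 * x, z)
  | (1, true) => (x + 2 * y, - (4 * y), z + 2 * y)
  | (_, true) => (x, y + 2 * z, - (4 * z))
  | (0, false) => (- x, 4 * y + 2 * x, 4 * z)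
  | (1, false) => (4 * x + 2 * y, - y, 4 * z + 2 * y)
  | (_, false) => (4 * x, 4 * y + 2 * z, - z)
  end.

Definition burau (w : word nat) (v : Z * Z * Z) := foldr burau_letter v w.

Definition commutator_word (T : Type) (x y : word T) :=
  inv_word x ++ inv_word y ++ x ++ y.

Definition obstruction_word (T : Type) (x y z : word T) :=
  commutator_word
    (commutator_word (commutator_word x y) (commutator_word y z))
    (x ++ y ++ z).

Definition braid_obstruction_word (T : Type) (a b c : T) :=
  let s x := [:: (x, true); (x, true)] in
  obstruction_word (s a) (s b) ((b, false) :: s c ++ [:: (b, true)]).

Lemma burau_obstruction :
  (burau (braid_obstruction_word 0%N 1%N 2%N) (1, 0, 0)).1.2 <> 0.
Proof. by vm_compute. Qed.

Variables (Gamma : coxeter_graph) (a b c : Gamma).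
Hypotheses (ab : a <> b) (bc : b <> c) (ac : a <> c).
Hypotheses (mab : coxeter_m a b = Some 3) (mbc : coxeter_m b c = Some 3).
Hypothesis mac : coxeter_m a c = Some 2.

Let gen n := match n with 0 => a | 1 => b | _ => c end.

Let kappa (s t : Gamma) := bond (coxeter_m s t).

Let proportional (f : Gamma -> algC) (v : Z * Z * Z) :=
  let iota (x : Z) : algC := (int_of_Z x)%:~R in
  exists k : algC,
    [/\ k != 0, f a = k * iota v.1.1, f b = k * iota v.1.2
      & f c = k * iota v.2].

Lemma hecke_burau (w : word nat) f v : proportional f v ->
  proportional (hecke 4 kappa [seq (gen l.1, l.2) | l <- w] f) (burau w v).
Proof.
move=> fv; elim: w => //= -[n e] w; set g := hecke _ _ _ _.
move: g (burau w v) => g [[x y] z] [k [k0 /= ga gb gc]].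
have kab : kappa a b = 2 by rewrite /kappa mab bond3.
have kba : kappa b a = 2 by rewrite /kappa coxeter_mC mab bond3.
have kbc : kappa b c = 2 by rewrite /kappa mbc bond3.
have kcb : kappa c b = 2 by rewrite /kappa coxeter_mC mbc bond3.
have kac : kappa a c = 0 by rewrite /kappa mac bond2.
have kca : kappa c a = 0 by rewrite /kappa coxeter_mC mac bond2.
have nab := introF eqP ab; have nbc := introF eqP bc; have nac := introF eqP ac.
have nba := introF eqP (nesym ab); have ncb := introF eqP (nesym bc).
have nca := introF eqP (nesym ac).
exists (if e then k else k / 4); rewrite /hecke_letter /=.
case: n => [|[|n]]; case: e => /=;
  rewrite ?eqxx ?nab ?nbc ?nac ?nba ?ncb ?nca ?kab ?kba ?kbc ?kcb ?kac ?kca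
    ga gb gc ?mulf_neq0 ?invr_eq0 ?pnatr_eq0 //;
  by rewrite !(rmorph_nat, rmorphM, rmorphN, rmorphD); split=> //; field.
Qed.

(** The indicator function of [a] is the first basis vector of the Burau
coordinates, and it vanishes at [b] while its image does not. *)
Lemma braid_obstruction_neq1 :
  ~ pres_eq (@artin_rel Gamma) (braid_obstruction_word a b c) [::].
Proof.
move=> w1; pose f t : algC := if t == a then 1 else 0.
have: hecke 4 kappa (braid_obstruction_word a b c) f = f.
  rewrite (hecke_pres_eq _ _ _ _ w1) //.
  - by rewrite pnatr_eq0.
  - by move=> s t; rewrite /kappa coxeter_mC.
  - move=> s t m _ stm; rewrite /kappa stm; apply: bond_dihedral.
    exact: coxeter_m_ge2 stm.
have f100 : proportional f (1, 0, 0).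
  exists 1; split; rewrite ?oner_eq0 // /f;
    rewrite ?eqxx ?rmorph1 ?rmorph0 ?mulr1 ?mulr0 //.
    by case: eqP => // /esym.
  by case: eqP => // /esym.
have := hecke_burau (braid_obstruction_word 0%N 1%N 2%N) f100.
have -> : [seq (gen l.1, l.2) | l <- braid_obstruction_word 0%N 1%N 2%N]
  = braid_obstruction_word a b c by [].
have := burau_obstruction; move: (burau _ _) => r r0.
move=> [k [k0 _ gb _]] e; apply: r0; move: gb; rewrite e /f.
case: eqP => [/esym//|_] /esym/eqP.
rewrite mulf_eq0 (negbTE k0) /= intr_eq0 => /eqP r0.
by rewrite -[LHS]int_of_ZK r0.
Qed.

End Burau.

Section PureArtin.
Local Open Scope group_scope.

Definition generator (Gamma : coxeter_graph) (s : Gamma) : artin_group Gamma :=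
  pclass _ [:: (s, true)].

Lemma pclassM (X : choiceType) (R : word X -> word X -> Prop) u v :
  pclass R u * pclass R v = pclass R (u ++ v).
Proof. exact: pres_mulE. Qed.

Lemma obstruction_pclass (X : choiceType) (R : word X -> word X -> Prop) x y z :
  obstruction (pclass R x) (pclass R y) (pclass R z) =
  pclass R (obstruction_word x y z).
Proof.
have V u : (pclass R u)^-1 = pclass R (inv_word u) by apply: pres_invE.
have C u v : [~ pclass R u, pclass R v] = pclass R (commutator_word u v).
  rewrite /commg /conjg !V.
  by rewrite (pclassM R u v) (pclassM R (inv_word v)) (pclassM R (inv_word u)).
rewrite /obstruction (C x y) (C y z) (pclassM R x y) (pclassM R (x ++ y) z).
by rewrite (C (commutator_word x y)) (C (commutator_word _ _)) -catA.
Qed.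

Section Pure.
Variables (Gamma : coxeter_graph) (a b c : Gamma).
Hypotheses (ab : a <> b) (bc : b <> c) (ac : a <> c).
Hypotheses (mab : coxeter_m a b = Some 3) (mbc : coxeter_m b c = Some 3).
Hypothesis mac : coxeter_m a c = Some 2.

Lemma square_pure (s : Gamma) :
  ker_pred (@artin_to_coxeter Gamma) (generator s * generator s).
Proof.
have -> : generator s * generator s = pclass _ [:: (s, true); (s, true)].
  exact: pclassM.
apply/eqP; transitivity (pclass (@coxeter_rel Gamma) [:: (s, true); (s, true)]).
  by apply: pres_projE => u v; left.
by apply/pclassP/pres_eq_rel; right; exists s.
Qed.

Lemma conj_pure (g h : artin_group Gamma) :
  ker_pred (@artin_to_coxeter Gamma) g ->
  ker_pred (@artin_to_coxeter Gamma) (g ^ h).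
Proof.
rewrite /ker_pred /= => /eqP g1; apply/eqP.
rewrite /conjg !artin_to_coxeterM g1 mul1g -artin_to_coxeterM mulVg.
by apply: pres_projE => u v; left.
Qed.

Lemma pure_obstruction : exists x : pure_artin_group Gamma, x <> 1 /\
  forall (F : groupType) (f : {multiplicative pure_artin_group Gamma -> F}),
    commutation_transitive F -> f x = 1.
Proof.
pose P : groupType := pure_artin_group Gamma.
pose x : P := Kernel (square_pure a).
pose y : P := Kernel (square_pure b).
pose z : P := Kernel (conj_pure (generator b) (square_pure c)).
pose u : P := Kernel (conj_pure (generator b) (square_pure a)).
pose v : P := Kernel (square_pure c).
have gen2 (p q : Gamma) : generator p * generator q =
    pclass (@artin_rel Gamma) [:: (p, true); (q, true)] by exact: pclassM.
have braid (s t : Gamma) : s <> t -> coxeter_m s t = Some 3 ->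
    generator s * generator t * generator s =
    generator t * generator s * generator t.
  have gen3 (p q r : Gamma) : generator p * generator q * generator r =
      pclass (@artin_rel Gamma) [:: (p, true); (q, true); (r, true)].
    by rewrite gen2; apply: pclassM.
  move=> st m3; rewrite !gen3; apply/pclassP/pres_eq_rel.
  by exists s, t, 3.
have comm_ac : commute (generator a) (generator c).
  by rewrite /commute !gen2; apply/pclassP/pres_eq_rel; exists a, c, 2.
have [ux uy vy vz [wu wv]] :=
  braid_obstruction_relations (braid _ _ ab mab) (esym (braid _ _ bc mbc))
    comm_ac.
exists (obstruction x y z); split; last first.
  move=> F f CT; apply: (obstruction_killed f (u := u) (v := v) CT).
  by split; [| | | |split]; apply: val_inj.
move/(congr1 (val : P -> artin_group Gamma)).
have -> : val (obstruction x y z) = obstruction (val x) (val y) (val z).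
  exact: (gmulf_obstruction
    (val : pure_artin_group Gamma -> artin_group Gamma)).
have zE : val z = pclass _ [:: (b, false); (c, true); (c, true); (b, true)].
  have bV : (generator b)^-1 = pclass _ [:: (b, false)] by apply: pres_invE.
  rewrite /= conjgE bV gen2 (pclassM _ [:: (c, true); (c, true)]).
  exact: pclassM.
rewrite zE /= !gen2 obstruction_pclass.
by move/pclassP; apply: braid_obstruction_neq1.
Qed.
End Pure.

End PureArtin.

Theorem corollary4p9 (Gamma : coxeter_graph) :
  contains_A 3 Gamma -> ~ residually_free (pure_artin_group Gamma).
Proof.
case=> f [inj_f adjE labE] resfree.
have ne (i j : 'I_3) : i != j -> f i <> f j by move=> /eqP ij /inj_f.
have m3 (i j : 'I_3) : (i.+1 == j) -> coxeter_m (f i) (f j) = Some 3.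
  by move=> ij; rewrite /coxeter_m; case: ifP => [/labE//|]; rewrite adjE ij.
pose i0 := @Ordinal 3 0 isT; pose i1 := @Ordinal 3 1 isT.
pose i2 := @Ordinal 3 2 isT.
have m2 : coxeter_m (f i0) (f i2) = Some 2 by rewrite /coxeter_m adjE.
have [x [x1 xF]] := pure_obstruction (ne i0 i1 isT) (ne i1 i2 isT)
  (ne i0 i2 isT) (m3 i0 i1 isT) (m3 i1 i2 isT) m2.
have [X [g gx]] := resfree x x1.
by apply/gx/xF/free_group_commutation_transitive.
Qed.
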